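(* Let $k\ge1$ be an integer. The restricted wreath product $\mathbb{Z}_3\,\mathrm{wr}\,\mathbb{Z}^k$ has the property $R_\infty$ if $k$ is odd, and does not have the property $R_\infty$ if $k$ is even.
   Context: For an automorphism $\phi$ of a group $G$, $R(\phi)$ is the number of classes of the relation $g\sim hg\phi(h^{-1})$, $h,g\in G$. A group has property $R_\infty$ if $R(\phi)=\infty$ for every automorphism $\phi$. $\mathbb{Z}_3\,\mathrm{wr}\,\mathbb{Z}^k=\left(\bigoplus_{x\in\mathbb{Z}^k}A_x\right)\rtimes_\alpha\mathbb{Z}^k$, with $A_x\cong\mathbb{Z}_3$ generated by $\delta_x$, finitely supported direct sum, and $\alpha(y)(\delta_x)=\delta_{y+x}$. *)

(* Defs.v *)
From mathcomp Require Import all_boot all_algebra.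
Set Implicit Arguments. Unset Strict Implicit. Unset Printing Implicit Defensive.
Import GRing.Theory.
Local Open Scope ring_scope.

Definition Zk (k : nat) := 'rV[int]_k.
Definition base (k : nat) := (Zk k -> 'Z_3).
Definition carrier (k : nat) := (base k * Zk k)%type.

(* semidirect product law with alpha(y)(delta_x) = delta_(y+x),
   i.e. (alpha(y) b)(x) = b(x - y) *)
Definition wmul k (g h : carrier k) : carrier k :=
  (fun x => g.1 x + h.1 (x - g.2), g.2 + h.2).
Definition winv k (g : carrier k) : carrier k :=
  (fun x => - g.1 (x + g.2), - g.2).
Definition wone k : carrier k := (fun _ => 0, 0).

Definition finsupp k (a : base k) : Prop :=
  exists s : seq (Zk k), forall x, a x != 0 -> x \in s.

Definition inWR k (g : carrier k) : Prop := finsupp g.1.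

(* automorphism of the group Z_3 wr Z^k (values outside the group irrelevant) *)
Definition is_aut k (phi : carrier k -> carrier k) : Prop :=
  [/\ (forall g, inWR g -> inWR (phi g)),
      (forall g h, inWR g -> inWR h -> phi (wmul g h) = wmul (phi g) (phi h)),
      (forall g h, inWR g -> inWR h -> phi g = phi h -> g = h) &
      (forall g, inWR g -> exists h, inWR h /\ phi h = g)].

Definition twisted_conj k (phi : carrier k -> carrier k) (g g' : carrier k) : Prop :=
  exists h, inWR h /\ g' = wmul (wmul h g) (phi (winv h)).

Definition finitely_many_classes k (phi : carrier k -> carrier k) : Prop :=
  exists (n : nat) (r : 'I_n -> carrier k),
    (forall i, inWR (r i)) /\
    (forall g, inWR g -> exists i, twisted_conj phi (r i) g).

Definition R_infty (k : nat) : Prop :=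
  forall phi : carrier k -> carrier k, is_aut phi -> ~ finitely_many_classes phi.

(* Main.v *)
(* An automorphism phi acts on the quotient Z^k by some A in GL_k(Z), because
   the base group is the set of solutions of g^3 = 1. Since the
   only units of F_3[Z^k] are the monomials, phi maps delta_x to
   eps delta_(xA+v). If R(phi) is finite then det(1 - A) <> 0. The elements
   (a, -v) and (b, -v) are then conjugate iff b - a = c - eps (c moved by A) for
   some c; orbits of A that are infinite, or finite of length n with eps^n = 1,
   each contribute a nonzero cokernel, so all but finitely many orbits are finite
   of odd length. Multiples of a basis vector lie in distinct orbits, so A has
   odd order, and then det(1 - A) = 0 in odd dimension k.
   In even dimension, take A of order 3 without fixed vectors and
   delta_x |-> - delta_(xA). *)
Require Import Defs.
From mathcomp Require Import all_boot all_order all_algebra zify ring.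
From Stdlib Require Import Classical FunctionalExtensionality.
Set Implicit Arguments. Unset Strict Implicit. Unset Printing Implicit Defensive.
Import Order.TTheory GRing.Theory Num.Theory.
Local Open Scope ring_scope.

(** * Integer matrices of odd order in odd dimension *)

Lemma odd_expr_eq1 (d : int) (J : nat) : odd J -> d ^+ J = 1 -> d = 1.
Proof.
move=> oJ dJ; have J0 : (0 < J)%N by case: J oJ {dJ}.
have d0 : 0 < d by rewrite -(exprn_odd_gt0 d oJ) dJ.
by apply/eqP; rewrite -(pexpr_eq1 J0 (ltW d0)) dJ.
Qed.

Lemma odd_order_det_eq0 (k J : nat) (A : 'M[int]_k) :
  odd k -> odd J -> A ^+ J = 1 -> \det (1 - A) = 0.
Proof.
case: J => // J ok oJ AJ.
have A1 : A *m A ^+ J = 1%:M by move: AJ; rewrite exprS.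
have dA : \det A = 1.
  apply: (odd_expr_eq1 oJ).
  have <- : \det (A ^+ J.+1) = \det A ^+ J.+1.
    elim: (J.+1) => [|n IH]; first by rewrite !expr0 det1.
    by rewrite !exprS -IH -det_mulmx.
  by rewrite AJ det1.
(* Averaging over the powers of [A] yields an invariant form [B]. It is positive definite: [v B v^T]
   is a sum of squares in which [j = 0] contributes the squared length of [v]. *)
pose F j := (A ^+ j) *m (A ^+ j)^T.
pose B : 'M[int]_k := \sum_(j < J.+1) F j.
have AB : A *m B *m A^T = B.
  have FS j : A *m F j *m A^T = F j.+1.
    by rewrite /F exprS trmx_mul !mulmxA.
  rewrite /B mulmx_sumr mulmx_suml; under eq_bigr do rewrite FS.
  rewrite big_ord_recr [RHS]big_ord_recl /= addrC; congr (_ + _).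
  by rewrite /F AJ expr0.
have dB : \det B != 0.
  apply/negP => /det0P [v v0 vB].
  have vF j : (v *m F j *m v^T) 0 0 = \sum_i ((v *m A ^+ j) 0 i) ^+ 2.
    rewrite /F mulmxA -mulmxA -trmx_mul mxE; apply: eq_bigr => i _.
    by rewrite !mxE expr2.
  have : (v *m B *m v^T) 0 0 = 0 by rewrite vB mul0mx mxE.
  rewrite /B mulmx_sumr mulmx_suml summxE; under eq_bigr do rewrite vF.
  move=> /psumr_eq0P s0.
  have {}s0 := s0 (fun j _ => sumr_ge0 _ (fun i _ => sqr_ge0 _)) ord0 isT.
  move: s0; rewrite expr0 mulmx1 => /psumr_eq0P s0.
  case/negP: v0; apply/eqP/rowP => i; rewrite mxE; apply/eqP.
  by rewrite -sqrf_eq0 s0 // => j _; exact: sqr_ge0.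
(* B conjugates A^-1 to the transpose of A, so 1 - A and 1 - A^-1 have the
   same determinant; as 1 - A = - A (1 - A^-1), in odd dimension that
   determinant equals its opposite. *)
have AB' : A ^+ J *m B = B *m A^T.
  by rewrite -[in LHS]AB !mulmxA (mulmx1C A1) mul1mx.
have e1 : \det (1 - A ^+ J) = \det (1 - A).
  rewrite -[RHS]det_tr; apply: (mulIf dB); rewrite -det_mulmx [RHS]mulrC.
  rewrite -det_mulmx mulmxBl AB' linearB /= trmx1 mulmxBr.
  by rewrite mul1mx mulmx1.
have e2 : \det (1 - A ^+ J) = - \det (1 - A).
  rewrite -[LHS]mul1r -[1 in LHS]dA -det_mulmx mulmxBr A1 mulmx1.
  by rewrite -opprB -scaleN1r detZ -signr_odd ok expr1 mulN1r.
by move: e2; rewrite e1; lia.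
Qed.

(** * Arithmetic modulo 3 and finitely supported functions *)

Lemma Z3_cases (c : 'Z_3) : [\/ c = 0, c = 1 | c = -1].
Proof.
case: c => [[|[|[|n]]]] //= i; [apply: Or31|apply: Or32|apply: Or33]; exact: val_inj.
Qed.

Lemma Z3_mulf_eq0 (c d : 'Z_3) : c * d = 0 -> c = 0 \/ d = 0.
Proof.
case: (Z3_cases c) => ->; [by left | |]; rewrite ?mul1r ?mulN1r; first by right.
by move=> /eqP; rewrite oppr_eq0 => /eqP; right.
Qed.

Lemma Z3_sqr (c : 'Z_3) : c <> 0 -> c * c = 1.
Proof. by case: (Z3_cases c) => ->; rewrite ?mulrNN ?mul1r. Qed.

Section BaseGroup.
Variable k : nat.
Implicit Types (a b : base k) (x y z : Zk k).

Definition dirac x : base k := fun z => (z == x)%:R.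

Lemma finsupp0 : finsupp (fun _ : Zk k => 0 : 'Z_3).
Proof. by exists [::] => x; rewrite eqxx. Qed.

Lemma finsupp_dirac x : finsupp (dirac x).
Proof.
by exists [:: x] => z; rewrite /dirac inE; case: (z == x) => //; rewrite eqxx.
Qed.

Lemma finsuppD a b : finsupp a -> finsupp b -> finsupp (fun x => a x + b x).
Proof.
move=> [s sa] [t tb]; exists (s ++ t) => x; rewrite mem_cat.
case: (eqVneq (a x) 0) => [->|/sa -> //]; rewrite add0r => /tb ->.
by rewrite orbT.
Qed.

Lemma finsuppN a : finsupp a -> finsupp (fun x => - a x).
Proof. by move=> [s sa]; exists s => x; rewrite oppr_eq0 => /sa. Qed.

Lemma finsupp_comp a (g h : Zk k -> Zk k) :
  cancel g h -> finsupp a -> finsupp (fun x => a (g x)).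
Proof.
move=> gK [s sa]; exists (map h s) => x /sa xs.
by rewrite -(gK x) map_f.
Qed.

Lemma finsupp_vanish a (y : nat -> Zk k) :
  finsupp a -> injective y -> exists n, a (y n) = 0.
Proof.
move=> [s sa] yI; apply: NNPP => H.
have : (size (map y (iota 0 (size s).+1)) <= size s)%N.
  apply: uniq_leq_size; first by rewrite map_inj_uniq ?iota_uniq.
  move=> _ /mapP [n _ ->]; apply: sa; apply/eqP => E; apply: H.
  by exists n.
by rewrite size_map size_iota ltnn.
Qed.

(** Additivity already gives linearity, because every scalar of Z_3 is 0, 1 or -1. *)
Lemma additive_dirac_expansion (F : base k -> 'Z_3) (s : seq (Zk k)) a :
  (forall a b, finsupp a -> finsupp b -> F (fun x => a x + b x) = F a + F b) ->
  uniq s -> (forall x, a x != 0 -> x \in s) ->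
  F a = \sum_(x <- s) a x * F (dirac x).
Proof.
move=> FD.
have F0 : F (fun _ => 0) = 0.
  have := FD _ _ finsupp0 finsupp0.
  have -> : (fun _ : Zk k => 0 + 0 : 'Z_3) = (fun _ => 0).
    by apply: functional_extensionality => z; rewrite addr0.
  by move/eqP; rewrite -subr_eq subrr => /eqP.
elim: s a => [|x s IH] a /=.
  move=> _ sa; rewrite big_nil -[RHS]F0; congr F.
  apply: functional_extensionality => x; apply/eqP/negPn/negP => /sa.
  by rewrite in_nil.
move=> /andP [xs us] sa; rewrite big_cons.
pose a' z := if z == x then 0 else a z.
have sa' z : a' z != 0 -> z \in s.
  rewrite /a'; case: (eqVneq z x) => [_ //|zx az].
  by have := sa z az; rewrite inE (negbTE zx).
have fa' : finsupp a' by exists s.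
have Fdirac c : F (fun z => c * dirac x z) = c * F (dirac x).
  have fx := finsupp_dirac x.
  case: (Z3_cases c) => ->.
  - rewrite mul0r -[RHS]F0; congr F.
    by apply: functional_extensionality => z; rewrite mul0r.
  - rewrite mul1r; congr F.
    by apply: functional_extensionality => z; rewrite mul1r.
  - rewrite mulN1r; apply/eqP; rewrite -addr_eq0 -FD //.
      apply/eqP; rewrite -[RHS]F0; congr F.
      by apply: functional_extensionality => z; rewrite mulN1r addNr.
    have -> : (fun z => -1 * dirac x z) = (fun z => - dirac x z).
      by apply: functional_extensionality => z; rewrite mulN1r.
    exact: finsuppN.
have -> : a = (fun z => a x * dirac x z + a' z).
  apply: functional_extensionality => z; rewrite /dirac /a'.
  by case: eqP => [->|_]; rewrite ?mulr1 ?addr0 ?mulr0 ?add0r.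
have fxx : finsupp (fun z => a x * dirac x z).
  exists [:: x] => z; rewrite inE /dirac.
  by case: (z == x) => //; rewrite mulr0 eqxx.
rewrite FD // Fdirac (IH a') //; congr (_ + _).
  by rewrite /dirac /a' eqxx mulr1 addr0.
rewrite !big_seq; apply: eq_bigr => z zs; congr (_ * _).
rewrite /dirac /a'; case: eqP => [zx|_]; first by rewrite -zx zs in xs.
by rewrite mulr0 add0r.
Qed.
End BaseGroup.

(** * Units of the group ring F_3[Z^k] *)

Lemma seq_argmax (T : eqType) (l : T -> int) (s : seq T) x0 :
  x0 \in s -> exists2 x, x \in s & forall y, y \in s -> l y <= l x.
Proof.
elim: s x0 => // z s IH x0 _; case: s IH => [|z' s] IH.
  by exists z; rewrite ?mem_head // => y; rewrite inE => /eqP ->.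
have [x xs xmax] := IH z' (mem_head _ _).
have [lz|lz] := lerP (l z) (l x).
  exists x; first by rewrite in_cons xs orbT.
  by move=> y; rewrite in_cons => /predU1P [-> //|/xmax].
exists z; rewrite ?mem_head // => y; rewrite in_cons => /predU1P [-> //|/xmax h].
exact: le_trans h (ltW lz).
Qed.

Section TrivialUnits.
Variable k : nat.
Implicit Types (x y z d : Zk k).

(** A vector is read as the polynomial with these coefficients, and [l] evaluates it at an integer
    [t] that is a root of none of the polynomials coming from [D]. *)
Lemma separating_functional (D : seq (Zk k)) :
  (forall d, d \in D -> d != 0) ->
  exists l : Zk k -> int, (forall x y, l (x + y) = l x + l y) /\
    (forall d, d \in D -> l d != 0).
Proof.
move=> D0; pose p := \prod_(d <- D) rVpoly d : {poly int}.
have p0 : p != 0.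
  rewrite prodf_seq_neq0; apply/allP => d /D0 d0; apply/implyP => _.
  by apply: contra d0 => /eqP E; rewrite -(rVpolyK d) E linear0.
have [t pt] : exists t, p.[t] != 0.
  apply: NNPP => H.
  (* A nonzero polynomial has fewer than [size p] roots, so one of these [size p] integers is not a
     root. *)
  pose rs := [seq Posz n | n <- iota 0 (size p)].
  have : (size rs < size p)%N.
    apply: max_poly_roots p0 _ _.
      apply/allP => _ /mapP [n _ ->]; apply/negPn/negP => r.
      by apply: H; exists n%:Z.
    by rewrite map_inj_uniq ?iota_uniq // => i j [].
  by rewrite size_map size_iota ltnn.
exists (fun x => (rVpoly x).[t]); split=> [x y|d dD].
  by rewrite linearD hornerD.
apply: contra pt => /eqP E.
by rewrite horner_prod (perm_big _ (perm_to_rem dD)) /= big_cons E mul0r.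
Qed.

(** The last hypothesis says that [w], moved by [A], times [u] is 1 in the group ring. At the sum of
    the two maximizers of [l] only one product contributes, and it is nonzero; so this sum is 0. *)
Lemma top_coefficients (u w : base k) (A : 'M[int]_k) (s t : seq (Zk k))
    (l : Zk k -> int) :
  (forall x y, l (x + y) = l x + l y) ->
  uniq s ->
  (forall x, (w x != 0) = (x \in s)) -> (forall x, (u x != 0) = (x \in t)) ->
  {in t &, injective l} -> {in s &, injective (fun x => l (x *m A))} ->
  (forall z, \sum_(x <- s) w x * u (z - x *m A) = dirac 0 z) ->
  exists a b, [/\ a \in t, b \in s, a + b *m A = 0,
    forall y, y \in t -> l y <= l a &
    forall y, y \in s -> l (y *m A) <= l (b *m A)].
Proof.
move=> lD us ws ut lt ls conv.
have [b0 b0s a0t] : exists2 x, x \in s & 0 - x *m A \in t.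
  apply: NNPP => H; have := conv 0.
  rewrite /dirac eqxx big_seq big1 // => x xs.
  have [->|ux] := eqVneq (u (0 - x *m A)) 0; first by rewrite mulr0.
  by case: H; exists x; rewrite -?ut.
have [a ta amax] := seq_argmax l a0t.
have [b sb bmax] := seq_argmax (fun x => l (x *m A)) b0s.
exists a, b; split=> //.
have := conv (a + b *m A); rewrite (perm_big _ (perm_to_rem sb)) /= big_cons.
rewrite addrK big_seq big1 ?addr0 => [|x xr].
  rewrite /dirac; case: eqP => // _ /Z3_mulf_eq0 [] /eqP E.
    by move: sb; rewrite -ws E.
  by move: ta; rewrite -ut E.
have xs := mem_rem xr.
have [->|ux] := eqVneq (u (a + b *m A - x *m A)) 0; first by rewrite mulr0.
have xb : x <> b by move=> E; move: xr; rewrite E mem_rem_uniq // !inE eqxx.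
case: xb; apply: ls => //; apply/eqP; rewrite eq_le bmax //=.
have := amax _ (etrans (esym (ut _)) ux).
have := lD (a + b *m A - x *m A) (x *m A); rewrite subrK lD.
by lia.
Qed.

(* Ordering Z^k by a generic linear functional, the top and the bottom terms of the product both sit at 0; this forces u to have a single term. *)
Lemma trivial_unit (u w : base k) (A : 'M[int]_k) (s : seq (Zk k)) :
  uniq s -> (forall x, (w x != 0) = (x \in s)) ->
  finsupp u -> (forall x y, x *m A = y *m A -> x = y) ->
  (forall z, \sum_(x <- s) w x * u (z - x *m A) = dirac 0 z) ->
  exists v, u v <> 0 /\ (forall z, z != v -> u z = 0).
Proof.
move=> us ws [t0 ut0] Ainj conv.
pose t := [seq x <- t0 | u x != 0].
have ut x : (u x != 0) = (x \in t).
  by rewrite mem_filter; case E: (u x != 0) => //=; rewrite ut0.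
(* Nonvanishing on these differences makes [l] injective on the support of [u] and on the moved
   support of [w]. *)
pose D := [seq d <- [seq x - y | x <- t, y <- t] ++
                    [seq (x - y) *m A | x <- s, y <- s] | d != 0].
have [d|l [lD lsep]] := @separating_functional D.
  by rewrite mem_filter => /andP [].
have l0 : l 0 = 0 by have := lD 0 0; rewrite addr0; lia.
have lB x y : l x = l y -> l (x - y) = 0.
  by have := lD (x - y) y; rewrite subrK; lia.
have lt : {in t &, injective l}.
  move=> x y xt yt /lB lxy; apply/eqP; rewrite -subr_eq0; apply/negPn/negP => d0.
  have /lsep : x - y \in D.
    by rewrite mem_filter d0 mem_cat (allpairs_f (fun x y => x - y)).
  by rewrite lxy.
have ls : {in s &, injective (fun x => l (x *m A))}.
  move=> x y xs ys /lB lxy; apply/eqP; rewrite -subr_eq0; apply/negPn/negP => d0.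
  have /lsep : (x - y) *m A \in D.
    rewrite mem_filter mem_cat (allpairs_f (fun x y => (x - y) *m A)) // orbT andbT.
    by apply: contraNneq d0 => E; apply/eqP/Ainj; rewrite E mul0mx.
  by rewrite mulmxBl lxy.
have [a [b [ta sb ab amax bmax]]] := top_coefficients lD us ws ut lt ls conv.
have lDN x y : - l (x + y) = - l x + - l y by rewrite lD opprD.
have [||a' [b' [ta' sb' ab' amin bmin]]] := top_coefficients lDN us ws ut _ _ conv.
- by move=> x y xt yt /oppr_inj; exact: lt.
- by move=> x y xs ys /oppr_inj; exact: ls.
exists a; split=> [E|z za]; first by move: ta; rewrite -ut E eqxx.
apply/eqP/negPn/negP; rewrite ut => zt; case/eqP: za; apply: lt => //.
(* Top and bottom sums both have [l]-value 0, so maximum and minimum of [l] agree on the support of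
   [u]; hence [l z = l a]. *)
have := lD a (b *m A); have := lD a' (b' *m A); rewrite ab ab' l0.
have := amax z zt; have := amin z zt; have := bmax b' sb'; have := amax a' ta'.
by lia.
Qed.
End TrivialUnits.

(** * Orbits of an invertible integer matrix *)

Lemma expr_inverse (R : pzRingType) (a b : R) n :
  a * b = 1 -> b * a = 1 -> a ^+ n * b ^+ n = 1.
Proof.
by move=> ab ba; rewrite -exprMn_comm ?ab ?expr1n // /GRing.comm ab ba.
Qed.

Section Orbits.
Variable k : nat.
Implicit Types (x y z : Zk k) (A B : 'M[int]_k).

Definition unit_vec (i : 'I_k) : Zk k := delta_mx 0 i.

(** An integer matrix sends [q e_i] to a vector divisible by [q]. Using [A] and its inverse, [p] and
    [q] divide each other. *)
Lemma multiple_in_orbit_eq A B (i : 'I_k) (p q : nat) : A *m B = 1%:M ->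
  (q%:Z *: unit_vec i) *m A = p%:Z *: unit_vec i -> p = q.
Proof.
have key C (r s : nat) :
    (s%:Z *: unit_vec i) *m C = r%:Z *: unit_vec i -> (s %| r)%N.
  rewrite -scalemxAl -rowE => /rowP /(_ i); rewrite !mxE !eqxx mulr1 => E.
  by have : (s%:Z %| r%:Z)%Z by rewrite -E dvdz_mulr.
move=> AB qA; apply/eqP; rewrite eqn_dvd (key _ _ _ qA) andbT.
by apply: (key B); rewrite -qA -mulmxA AB mulmx1.
Qed.

(* The relation on c is solvable only if the orbit of q e_i under A is finite
   (otherwise c vanishes far away in both directions, hence everywhere on the
   orbit) and of a length n with eps^n <> 1. The other point p e_i is never on
   that orbit. *)
Lemma orbit_odd A B (eps : 'Z_3) (c : base k) (i : 'I_k) (p q : nat) :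
  A *m B = 1%:M -> eps <> 0 -> finsupp c -> (0 < q)%N -> p <> q ->
  (forall z, dirac (q%:Z *: unit_vec i) (z *m A) =
     dirac (p%:Z *: unit_vec i) (z *m A) + c (z *m A) - eps * c z) ->
  exists2 n, odd n & unit_vec i *m A ^+ n = unit_vec i.
Proof.
move=> AB e0 fc q0 pq; set x := q%:Z *: unit_vec i => rec0.
have BA := mulmx1C AB.
have ABn n : A ^+ n *m B ^+ n = 1%:M := expr_inverse n AB BA.
have BAn n : B ^+ n *m A ^+ n = 1%:M := expr_inverse n BA AB.
have rec z : z *m A <> p%:Z *: unit_vec i -> c (z *m A) = eps * c z + dirac x (z *m A).
  move=> zp; rewrite rec0 /dirac; case: eqP => // _.
  by rewrite add0r addrC subrK.
have recA n : c (x *m A ^+ n.+1) = eps * c (x *m A ^+ n) + dirac x (x *m A ^+ n.+1).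
  have E : x *m A ^+ n.+1 = x *m A ^+ n *m A by rewrite exprSr mulmxA.
  rewrite E; apply: rec; rewrite -E => /(multiple_in_orbit_eq (ABn _)); exact: pq.
have recB n : c (x *m B ^+ n) = eps * c (x *m B ^+ n.+1) + dirac x (x *m B ^+ n).
  have E : x *m B ^+ n = x *m B ^+ n.+1 *m A.
    by rewrite exprSr mulmxA -mulmxA BA mulmx1.
  rewrite E; apply: rec; rewrite -E => /(multiple_in_orbit_eq (BAn _)); exact: pq.
have cycle_from C D m n : (forall j, C ^+ j *m D ^+ j = 1%:M) -> (m < n)%N ->
    x *m C ^+ m = x *m C ^+ n -> x *m C ^+ (n - m) = x.
  move=> CD mn; rewrite -[in X in _ = X -> _](subnK (ltnW mn)) exprD mulmxA.
  by move/(congr1 (mulmx^~ (D ^+ m))); rewrite -!mulmxA CD !mulmx1.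
have [[n n0 xn]|inf] := classic (exists2 n, (0 < n)%N & x *m A ^+ n = x).
  have ex : exists n, (0 < n)%N && (x *m A ^+ n == x) by exists n; rewrite n0 xn eqxx.
  case: (ex_minnP ex) => {n n0 xn} n /andP [n0 /eqP xn] nmin.
  have cn j : (j < n)%N -> c (x *m A ^+ j) = eps ^+ j * c x.
    elim: j => [|j IH] jn; first by rewrite !expr0 mulmx1 mul1r.
    rewrite recA IH ?(ltnW jn) // mulrA -exprS /dirac.
    case: eqP => [E|_]; last by rewrite addr0.
    by have := nmin j.+1; rewrite E eqxx => /(_ isT); rewrite leqNgt jn.
  (* One turn around the orbit meets the point mass at [x] exactly once. For even [n] one has
     [eps ^+ n = 1], and the equation would read 0 = 1. *)
  have cx : c x = eps ^+ n * c x + 1.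
    rewrite -[in LHS]xn -(prednK n0) recA cn ?prednK // mulrA -exprS prednK //.
    by rewrite /dirac xn eqxx.
  exists n.
    apply: contraT => even_n; move: cx.
    suff -> : eps ^+ n = 1 by rewrite mul1r => /eqP; rewrite -subr_eq0 opprD addrA subrr.
    rewrite -(odd_double_half n) (negbTE even_n) add0n -mul2n exprM expr2 Z3_sqr //.
    by rewrite expr1n.
  apply/rowP => j; move/rowP/(_ j): xn; rewrite /x -scalemxAl 2!mxE [RHS]mxE.
  by apply: mulfI; rewrite eqz_nat -lt0n.
have noreturn C D : (forall j, C ^+ j *m D ^+ j = 1%:M) ->
    (forall n, (0 < n)%N -> x *m C ^+ n <> x) -> injective (fun n => x *m C ^+ n).
  move=> CD noC m n /= E; case: (ltngtP m n) => // mn.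
    by case: (noC (n - m)%N); rewrite ?subn_gt0 //; exact: cycle_from CD mn E.
  by case: (noC (m - n)%N); rewrite ?subn_gt0 //; exact: cycle_from CD mn (esym E).
have noA n : (0 < n)%N -> x *m A ^+ n <> x by move=> n0 E; apply: inf; exists n.
have noB n : (0 < n)%N -> x *m B ^+ n <> x.
  by move=> n0 E; apply: (noA n n0); rewrite -[in LHS]E -mulmxA BAn mulmx1.
(* Exponents start at 1 so that the zero found lies strictly before [x]. It spreads forward to
   [x *m B], a zero on the other side spreads back to [x], and the relation at [x] becomes 0 = 1. *)
have injB : injective (fun n => x *m B ^+ n.+1).
  by move=> m n /(noreturn _ _ BAn noB) [].
have [m cm] := finsupp_vanish fc (noreturn _ _ ABn noA).
have [n cn] := finsupp_vanish fc injB.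
have dirac_off y : y <> x -> dirac x y = 0 by rewrite /dirac; case: eqP.
have cx : c x = 0.
  elim: m cm => [|m IH]; first by rewrite expr0 mulmx1.
  by rewrite recA dirac_off ?addr0; [move=> /Z3_mulf_eq0 [] | exact: noA].
have cB : c (x *m B) = 0.
  elim: n cn => [|n IH]; first by rewrite expr1.
  by move=> cn; apply: IH; rewrite recB cn mulr0 dirac_off ?addr0 //; exact: noB.
by have := recB 0%N; rewrite expr1 cB mulr0 expr0 mulmx1 cx /dirac eqxx.
Qed.

Lemma unit_vec_fixed_expr A (n m : nat) (i : 'I_k) :
  unit_vec i *m A ^+ n = unit_vec i -> unit_vec i *m A ^+ (n * m) = unit_vec i.
Proof.
move=> E; rewrite exprM; elim: m => [|m IH]; first by rewrite expr0 mulmx1.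
by rewrite exprS mulmxA E.
Qed.

(** The product of the return times of the basis vectors is odd and is a common return time. *)
Lemma odd_order A :
  (forall i, exists2 n, odd n & unit_vec i *m A ^+ n = unit_vec i) ->
  exists2 J, odd J & A ^+ J = 1.
Proof.
move=> H; have [n Hn] := fin_all_exists (fun i => let: ex_intro2 n a b := H i in
  ex_intro (fun n => odd n /\ unit_vec i *m A ^+ n = unit_vec i) n (conj a b)).
exists (\prod_i n i)%N.
  by elim/big_ind: _ => // [a b oa ob|i _]; [rewrite oddM oa | case: (Hn i)].
apply/row_matrixP => i; rewrite !rowE (bigD1 i) //=.
by rewrite [LHS](unit_vec_fixed_expr _ (Hn i).2) mulmx1.
Qed.
End Orbits.

(** * The group structure of the wreath product *)

Section Group.
Variable k : nat.
Implicit Types (g h r : carrier k) (a b c : base k) (x y z : Zk k).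

Lemma carrier_eq g h : (forall x, g.1 x = h.1 x) -> g.2 = h.2 -> g = h.
Proof.
case: g h => [a y] [b z] /= ab ->; congr (_, _).
exact: functional_extensionality.
Qed.

Lemma wmulA g h r : wmul g (wmul h r) = wmul (wmul g h) r.
Proof. by apply: carrier_eq => [x|] /=; rewrite ?opprD addrA ?addrA. Qed.

Lemma wmul1g g : wmul (wone k) g = g.
Proof. by apply: carrier_eq => [x|] /=; rewrite ?subr0 add0r. Qed.

Lemma wmulg1 g : wmul g (wone k) = g.
Proof. by apply: carrier_eq => [x|] /=; rewrite addr0. Qed.

Lemma wmulVg g : wmul (winv g) g = wone k.
Proof. by apply: carrier_eq => [x|] /=; rewrite ?opprK addNr. Qed.

Lemma wmulgV g : wmul g (winv g) = wone k.
Proof. by apply: carrier_eq => [x|] /=; rewrite ?subrK subrr. Qed.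

Lemma inWR_mul g h : inWR g -> inWR h -> inWR (wmul g h).
Proof.
move=> fg fh; apply: finsuppD => //.
by apply: finsupp_comp fh; exact: subrK.
Qed.

Lemma inWR_inv g : inWR g -> inWR (winv g).
Proof. by move=> fg; apply/finsuppN/(finsupp_comp _ fg)/addrK. Qed.

Definition trans y : carrier k := (fun _ => 0, y).

Lemma inWR_trans y : inWR (trans y).
Proof. exact: finsupp0. Qed.

Lemma carrier_split a y : (a, y) = wmul (a, 0) (trans y).
Proof. by apply: carrier_eq => [x|] /=; rewrite ?addr0 ?add0r. Qed.

Lemma trans_base_commute a y :
  wmul (trans y) (a, 0) = wmul (fun x => a (x - y), 0) (trans y).
Proof. by apply: carrier_eq => [x|] /=; rewrite ?addr0 ?add0r. Qed.

Lemma wmul_idem g : wmul g g = g -> g = wone k.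
Proof. by move=> E; rewrite -[LHS]wmul1g -(wmulVg g) -wmulA E. Qed.

Lemma winv_uniq g h : wmul g h = wone k -> g = winv h.
Proof. by move=> E; rewrite -[LHS]wmulg1 -(wmulgV h) wmulA E wmul1g. Qed.

Lemma wpow3_base g : g.2 = 0 -> wmul g (wmul g g) = wone k.
Proof.
case: g => a y /= ->; apply: carrier_eq => [x|] /=; rewrite ?subr0 ?addr0 //.
by case: (Z3_cases (a x)) => ->; exact: val_inj.
Qed.

Lemma wpow3_snd g : wmul g (wmul g g) = wone k -> g.2 = 0.
Proof.
have int3 (t : int) : t + (t + t) = 0 -> t = 0 by lia.
move=> /(congr1 snd) /= /rowP E; apply/rowP => i; move: (E i); rewrite !mxE.
exact: int3.
Qed.

(** * Automorphisms and their twisted conjugacy classes *)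

Section Automorphism.
Variable phi : carrier k -> carrier k.
Hypothesis aut : is_aut phi.

Let phiW g : inWR g -> inWR (phi g). Proof. by case: aut => + _ _ _; apply. Qed.
Let phiM g h : inWR g -> inWR h -> phi (wmul g h) = wmul (phi g) (phi h).
Proof. by case: aut => _ + _ _; apply. Qed.
Let phi_inj g h : inWR g -> inWR h -> phi g = phi h -> g = h.
Proof. by case: aut => _ _ + _; apply. Qed.
Let phi_surj g : inWR g -> exists h, inWR h /\ phi h = g.
Proof. by case: aut => _ _ _ +; apply. Qed.

Let W1 : inWR (wone k). Proof. exact: finsupp0. Qed.

Lemma phi1 : phi (wone k) = wone k.
Proof.
have E := phiM W1 W1; rewrite wmulg1 in E.
exact: wmul_idem (esym E).
Qed.

Lemma phiV g : inWR g -> phi (winv g) = winv (phi g).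
Proof.
move=> Wg; have Wi := inWR_inv Wg.
by apply: winv_uniq; rewrite -phiM // wmulVg phi1.
Qed.

(** The base group is characteristic, being cut out by the equation [g^3 = 1]. *)
Lemma phi_snd_eq0 g : inWR g -> ((phi g).2 = 0) <-> (g.2 = 0).
Proof.
move=> Wg; have Wgg := inWR_mul Wg Wg; split=> E; apply: wpow3_snd.
  apply: phi_inj => //; first exact: inWR_mul.
  by rewrite !phiM // phi1 wpow3_base.
by rewrite -!phiM // wpow3_base // phi1.
Qed.

Let M y := (phi (trans y)).2.
Let f a := (phi (a, 0)).1.

Lemma phi_baseE a : finsupp a -> phi (a, 0) = (f a, 0).
Proof.
move=> fa; rewrite [LHS]surjective_pairing /f; congr (_, _).
by apply/phi_snd_eq0.
Qed.

Lemma phi_snd g : inWR g -> (phi g).2 = M g.2.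
Proof.
case: g => a y Wg; rewrite carrier_split.
by rewrite (phiM (Wg : inWR (a, 0)) (inWR_trans y)) phi_baseE //= !add0r.
Qed.

Lemma phi_snd_add y z : M (y + z) = M y + M z.
Proof.
rewrite /M -[RHS]/((wmul (phi (trans y)) (phi (trans z))).2) -phiM;
  [|exact: inWR_trans..].
by rewrite -/(M _) [RHS]phi_snd //; exact/inWR_mul/inWR_trans/inWR_trans.
Qed.

Lemma phi_snd_matrix :
  exists A B, A *m B = 1%:M /\ forall g, inWR g -> (phi g).2 = g.2 *m A.
Proof.
pose A : 'M[int]_k := \matrix_i M (unit_vec i).
have M0 : M 0 = 0 by apply/phi_snd_eq0 => //; exact: inWR_trans.
have MN y : M (- y) = - M y.
  by apply/eqP; rewrite -addr_eq0 -phi_snd_add addNr M0.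
have Mz (n : int) y : M (n *: y) = n *: M y.
  have Mn (m : nat) : M (m%:Z *: y) = m%:Z *: M y.
    elim: m => [|m IH]; first by rewrite !scale0r M0.
    by rewrite intS !scalerDl !scale1r phi_snd_add IH.
  by case: n => n; rewrite ?Mn // NegzE !scaleNr MN Mn.
have MA y : M y = y *m A.
  rewrite mulmx_sum_row [in LHS](row_sum_delta y).
  rewrite (big_morph M phi_snd_add M0); apply: eq_bigr => i _.
  by rewrite Mz rowK.
(* By surjectivity the unit translations have preimages; their quotient parts are the rows of a left
   inverse of [A]. *)
have [h Hh] := fin_all_exists (fun i : 'I_k => phi_surj (inWR_trans (unit_vec i))).
pose B : 'M[int]_k := \matrix_i (h i).2.
have BA : B *m A = 1%:M.
  apply/row_matrixP => i; rewrite row_mul rowK -MA -phi_snd; last by case: (Hh i).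
  by rewrite (Hh i).2 row1.
exists A, B; split; first exact: mulmx1C.
by move=> g /phi_snd ->.
Qed.

Lemma phi_base_add a b x : finsupp a -> finsupp b ->
  f (fun x => a x + b x) x = f a x + f b x.
Proof.
move=> fa fb; rewrite {1}/f.
have -> : (fun x => a x + b x, 0) = wmul (a, 0) (b, 0).
  by apply: carrier_eq => [y|] /=; rewrite ?subr0 ?addr0.
by rewrite phiM // !phi_baseE //= subr0.
Qed.

(** [phi] is applied to the commutation rule of translations with the base group; the base part of
    [phi (trans y)] occurs on both sides and cancels. *)
Lemma phi_base_shift a y x : finsupp a ->
  f (fun x => a (x - y)) x = f a (x - M y).
Proof.
move=> fa; have Wt := inWR_trans y.
have fa' : finsupp (fun x => a (x - y)) by apply: finsupp_comp fa; exact: subrK.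
have := congr1 phi (trans_base_commute a y); rewrite !phiM // !phi_baseE //.
move=> /(congr1 (fun g => g.1 x)) /=; rewrite subr0 addrC -/(M y).
by move/addIr.
Qed.

(** On the base group [phi] moves by [A] and multiplies by [u], the image of [dirac 0]. A preimage
    of [dirac 0] shows that [u] is a unit, hence a monomial. *)
Lemma phi_base_monomial A : injective (fun x : Zk k => x *m A) ->
  (forall g, inWR g -> (phi g).2 = g.2 *m A) ->
  exists v (eps : 'Z_3), eps <> 0 /\
    forall a x, finsupp a -> (phi (a, 0)).1 (x *m A + v) = eps * a x.
Proof.
move=> Ainj phiA; pose u := f (dirac 0).
have fu : finsupp u := @phiW (dirac 0, 0) (finsupp_dirac 0).
have f_dirac x z : f (dirac x) z = u (z - x *m A).
  rewrite /u -(phiA _ (inWR_trans x)) -[RHS](phi_base_shift x z (finsupp_dirac 0)).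
  congr (f _ z); apply: functional_extensionality => y.
  by rewrite /dirac subr_eq0.
have f_sum a s z : uniq s -> (forall x, a x != 0 -> x \in s) ->
    f a z = \sum_(x <- s) a x * u (z - x *m A).
  move=> us sa; rewrite (additive_dirac_expansion (F := fun a => f a z) _ us sa).
    by apply: eq_bigr => x _; rewrite f_dirac.
  by move=> b c fb fc; exact: phi_base_add.
have [[w y1] [Ww phiw]] := phi_surj (finsupp_dirac 0 : inWR (dirac 0, 0)).
have y0 : y1 = 0 by apply/(phi_snd_eq0 Ww); rewrite phiw.
rewrite {}y0 in Ww phiw; case: (Ww) => t0 wt0.
pose s := undup [seq x <- t0 | w x != 0].
have ws x : (w x != 0) = (x \in s).
  rewrite mem_undup mem_filter; case E: (w x != 0) => //=; by rewrite wt0.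
have [z|v [uv uoff]] := trivial_unit (undup_uniq _) ws fu Ainj.
  by rewrite -f_sum ?undup_uniq // => [|x]; rewrite ?ws // /f phiw.
exists v, (u v); split=> // a x [t ta].
(* Including [x] lets its term be isolated even when [a x = 0]. *)
pose s' := undup (x :: t).
have xs : x \in s' by rewrite mem_undup mem_head.
rewrite -/(f a) (f_sum a s') ?undup_uniq //; last first.
  by move=> y /ta yt; rewrite mem_undup inE yt orbT.
rewrite (perm_big _ (perm_to_rem xs)) /= big_cons [_ + v]addrC addrK.
rewrite [RHS]mulrC big_seq big1; first by rewrite addr0.
move=> y; rewrite rem_filter ?undup_uniq // mem_filter => /andP [/= yx _].
rewrite uoff ?mulr0 //; apply: contra yx.
by rewrite -addrA -subr_eq0 [v + _]addrC addrK subr_eq0 eq_sym => /eqP /Ainj ->.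
Qed.

Lemma twisted_conj_joint r g h : inWR r ->
  twisted_conj phi r g -> twisted_conj phi r h -> twisted_conj phi g h.
Proof.
move=> Wr [s [Ws ->]] [t [Wt ->]].
have [Wsi Wti] := (inWR_inv Ws, inWR_inv Wt).
exists (wmul t (winv s)); split; first exact: inWR_mul.
have <- : wmul s (winv t) = winv (wmul t (winv s)).
  by apply: winv_uniq; rewrite -wmulA [wmul (winv t) _]wmulA wmulVg wmul1g wmulgV.
rewrite phiM // !wmulA -[wmul (wmul t (winv s)) s]wmulA wmulVg wmulg1.
congr wmul; rewrite -[RHS]wmulA -phiM // wmulVg phi1 ?wmulg1 //.
Qed.

Lemma twisted_conj_pigeonhole (g : nat -> carrier k) :
  finitely_many_classes phi -> (forall n, inWR (g n)) ->
  exists m n, m <> n /\ twisted_conj phi (g m) (g n).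
Proof.
move=> [N [r [Wr cls]]] Wg.
have [i Hi] := fin_all_exists (fun n : 'I_N.+1 => cls _ (Wg n)).
have /injectivePn [m [n mn imn]] : ~~ injectiveb i.
  by apply/injectiveP => /leq_card; rewrite !card_ord ltnn.
exists m, n; split; first by move/val_inj/eqP; rewrite (negbTE mn).
by apply: (twisted_conj_joint (Wr (i m))); [exact: Hi | rewrite imn; exact: Hi].
Qed.

(** A vector [w] killed by the transpose of [1 - A] gives a pairing that is constant on twisted
    classes. Two distinct multiples of [e_i] share a class, so each coordinate of [w] is 0. *)
Lemma det_sub1_neq0 A : (forall g, inWR g -> (phi g).2 = g.2 *m A) ->
  finitely_many_classes phi -> \det (1 - A) != 0.
Proof.
move=> phiA fin; apply/negP; rewrite -det_tr => /det0P [w w0 wA].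
case/negP: w0; apply/eqP/rowP => i; rewrite [RHS]mxE.
have [m [n [mn [h [Wh E]]]]] := twisted_conj_pigeonhole fin
  (fun n => inWR_trans (n%:Z *: unit_vec i)).
have {}E : (n%:Z - m%:Z) *: unit_vec i = h.2 *m (1 - A).
  move/(congr1 snd): E; rewrite /= phiA ?mulNmx; last exact: inWR_inv.
  by move=> E; rewrite scalerBl E mulmxBr mulmx1 addrAC addrK.
have : ((n%:Z - m%:Z) *: unit_vec i) *m w^T = 0.
  by rewrite E -mulmxA -[1 - A]trmxK -trmx_mul wA trmx0 mulmx0.
rewrite -scalemxAl -rowE => /rowP /(_ 0); rewrite !mxE => /eqP.
rewrite mulf_eq0 subr_eq0 eqz_nat => /orP [/eqP nm|/eqP //].
by case: mn.
Qed.

Lemma finite_classes_odd_order A : injective (fun x : Zk k => x *m A) ->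
  (forall g, inWR g -> (phi g).2 = g.2 *m A) ->
  (exists B, A *m B = 1%:M) -> finitely_many_classes phi ->
  exists2 J, odd J & A ^+ J = 1.
Proof.
move=> Ainj phiA [B AB] fin; apply: odd_order => i.
have detA := det_sub1_neq0 phiA fin.
have [v [eps [eps0 phif]]] := phi_base_monomial Ainj phiA.
(* The translation part [- v] cancels the shift by [v] in the action on the base group; [n.+1] keeps
   the multiples nonzero. *)
have [m [n [mn [[c y] [Wc E]]]]] := @twisted_conj_pigeonhole
  (fun n => (dirac (n.+1%:Z *: unit_vec i), - v)) fin (fun n => finsupp_dirac _).
have y0 : y = 0.
  move/(congr1 snd): E; rewrite /= phiA ?mulNmx; last exact: inWR_inv.
  move=> /eqP; rewrite addrAC -subr_eq subrr eq_sym /= => /eqP E.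
  apply/eqP/negPn/negP => y0; case/negP: detA; apply/det0P; exists y => //.
  by rewrite mulmxBr mulmx1.
rewrite {}y0 in Wc E.
apply: (orbit_odd (p := m.+1) (q := n.+1) (c := c) AB eps0) => // [|z].
  by case.
move/(congr1 (fun g => g.1 (z *m A))): E; rewrite phiV // phi_baseE //=.
rewrite subr0 add0r opprK addr0 [f c _](phif c z Wc) => ->.
by rewrite [c _ + _]addrC.
Qed.
End Automorphism.
End Group.

(** * Odd rank *)

Lemma R_infty_odd (k : nat) : odd k -> R_infty k.
Proof.
move=> ok phi aut fin.
have [A [B [AB phiA]]] := phi_snd_matrix aut.
have Ainj : injective (fun x : Zk k => x *m A).
  by move=> x y /(congr1 (mulmx^~ B)); rewrite -!mulmxA AB !mulmx1.
have [J oJ AJ] := finite_classes_odd_order aut Ainj phiA (ex_intro _ B AB) fin.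
have /negP := det_sub1_neq0 aut phiA fin.
by rewrite (odd_order_det_eq0 ok oJ AJ).
Qed.

(** * Even rank: an automorphism with finitely many classes *)

Section OrderThree.
Variable m : nat.
Implicit Types (x y : Zk (m + m)).

(** With [(a, b)] standing for [a + b w], [w] a primitive cube root of unity, this is multiplication
    by [w] on Z[w]^m. *)
Definition rot3 x : Zk (m + m) := row_mx (- rsubmx x) (lsubmx x - rsubmx x).
Definition rot3i x : Zk (m + m) := row_mx (rsubmx x - lsubmx x) (- lsubmx x).

Lemma rot3D x y : rot3 (x + y) = rot3 x + rot3 y.
Proof.
rewrite /rot3 add_row_mx.
by congr row_mx; apply/rowP => i; rewrite !mxE; ring.
Qed.

Lemma rot3iD x y : rot3i (x + y) = rot3i x + rot3i y.
Proof.
rewrite /rot3i add_row_mx.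
by congr row_mx; apply/rowP => i; rewrite !mxE; ring.
Qed.

Lemma rot3K : cancel rot3 rot3i.
Proof.
move=> x; rewrite /rot3i row_mxKl row_mxKr opprK subrK.
by rewrite hsubmxK.
Qed.

Lemma rot3iK : cancel rot3i rot3.
Proof.
move=> x; rewrite /rot3 row_mxKl row_mxKr opprK addrNK.
by rewrite hsubmxK.
Qed.

Lemma rot3i_sum x : rot3i (rot3i x) + rot3i x + x = 0.
Proof.
rewrite -[X in _ + X]hsubmxK /rot3i row_mxKl row_mxKr !add_row_mx -[RHS]row_mx0.
by congr row_mx; apply/rowP => i; rewrite !mxE; ring.
Qed.

Lemma rot3i_cube x : rot3i (rot3i (rot3i x)) = x.
Proof.
rewrite -[RHS]hsubmxK /rot3i !(row_mxKl, row_mxKr).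
by congr row_mx; apply/rowP => i; rewrite !mxE; ring.
Qed.

(** This is [(1 - w)(2 + w) = 3]; it puts all multiples of 3 in the image of [1 - rot3]. *)
Lemma rot3_triple x : let u := x + x + rot3 x in u - rot3 u = x + x + x.
Proof.
rewrite /= -[x]hsubmxK /rot3 !(row_mxKl, row_mxKr, add_row_mx) opp_row_mx add_row_mx.
by congr row_mx; apply/rowP => i; rewrite !mxE; ring.
Qed.

Lemma rot3N x : rot3 (- x) = - rot3 x.
Proof.
rewrite /rot3 opp_row_mx.
by congr row_mx; apply/rowP => i; rewrite !mxE; ring.
Qed.

Lemma rot3iN x : rot3i (- x) = - rot3i x.
Proof. by apply: (can_inj rot3K); rewrite rot3N !rot3iK. Qed.

(** The translation parts add up to a multiple of [1 + w + w^2 = 0]. *)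
Lemma rot3i_affine_cube x y : rot3i (rot3i (rot3i (x - y) - y) - y) = x.
Proof.
rewrite !(rot3iD, rot3iN) !rot3i_cube -[RHS]subr0 -(rot3i_sum y).
move: (rot3i y) (rot3i (rot3i y)) => y1 y2.
by apply/rowP => i; rewrite !mxE; ring.
Qed.

(** The sign turns [1 - T] into [1 + T] in the conjugacy equation. When [T^3 = 1], the former is
    nilpotent modulo 3 and the latter invertible. *)
Definition phi3 (g : carrier (m + m)) : carrier (m + m) :=
  (fun x => - g.1 (rot3i x), rot3 g.2).

Lemma phi3_aut : is_aut phi3.
Proof.
split=> [g Wg|g h Wg Wh|g h Wg Wh E|[a y] Wg].
- by apply/finsuppN/(finsupp_comp rot3iK).
- apply: carrier_eq => [x|] /=; last exact: rot3D.
  by rewrite rot3iD rot3iN rot3K opprD.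
- apply: carrier_eq => [x|]; last by apply/(can_inj rot3K)/(congr1 snd E).
  by have := congr1 (fun g => - g.1 (rot3 x)) E; rewrite /= !opprK rot3K.
- exists (fun x => - a (rot3 x), rot3i y); split.
    by apply/finsuppN/(finsupp_comp rot3K).
  by apply: carrier_eq => [x|] /=; rewrite ?opprK rot3iK.
Qed.

(* Conjugating trans r by (c, u) gives c + T c on the base group, where T, the composition with x |-> rot3i (x - y), satisfies T^3 = 1. Modulo 3 the inverse of 1 + T is -(1 - T + T^2). *)
Lemma phi3_conj (a : base (m + m)) (r u : Zk (m + m)) :
  finsupp a -> twisted_conj phi3 (trans r) (a, u + r - rot3 u).
Proof.
move=> fa; set y := u + r - rot3 u.
pose P x := rot3i (x - y); pose Q x := rot3 x + y.
have PK : cancel P Q by move=> x; rewrite /P /Q rot3iK subrK.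
have P3 x : P (P (P x)) = x by exact: rot3i_affine_cube.
pose c x := - (a x - a (P x) + a (P (P x))).
have fc : finsupp c.
  apply/finsuppN/finsuppD; first apply: finsuppD => //.
    exact/finsuppN/(finsupp_comp PK).
  exact: finsupp_comp PK (finsupp_comp PK fa).
exists (c, u); split=> //; apply: carrier_eq => [x|] /=; last by rewrite rot3N.
rewrite opprK addr0.
have -> : rot3i (x - (u + r)) + u = P x.
  by rewrite /P /y opprB addrA [x + _ - _]addrAC [RHS]rot3iD rot3K.
rewrite /c P3.
by case: (Z3_cases (a x)) => ->; case: (Z3_cases (a (P x))) => ->;
  case: (Z3_cases (a (P (P x)))) => ->; exact: val_inj.
Qed.

(** Translations by residue vectors modulo 3 represent all classes: conjugation absorbs the base
    part and every multiple of 3. *)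
Lemma phi3_finite : finitely_many_classes phi3.
Proof.
pose T := {ffun 'I_(m + m) -> 'I_3}.
pose r (t : T) : Zk (m + m) := \row_i (t i : nat)%:Z.
exists #|T|, (fun j => trans (r (enum_val j))); split=> [j|[a y] fa].
  exact: inWR_trans.
pose t : T := [ffun i => inord `|(y ord0 i %% 3)%Z|].
pose q : Zk (m + m) := \row_i (y ord0 i %/ 3)%Z.
exists (enum_rank t); rewrite enum_rankK.
suff -> : y = (q + q + rot3 q) + r t - rot3 (q + q + rot3 q).
  exact: phi3_conj.
have mod3 (n : int) : (`|(n %% 3)%Z| < 3)%N by lia.
have div3 (n : int) :
    n = (n %/ 3)%Z + (n %/ 3)%Z + (n %/ 3)%Z + `|(n %% 3)%Z|%N%:Z by lia.
by rewrite addrAC rot3_triple; apply/rowP => i; rewrite !mxE ffunE inordK.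
Qed.
End OrderThree.

Lemma not_R_infty_even (k : nat) : ~~ odd k -> ~ R_infty k.
Proof.
move=> ek; rewrite -(odd_double_half k) (negbTE ek) -addnn add0n => H.
exact: H (@phi3_aut _) (@phi3_finite _).
Qed.

Theorem theorem4p1 (k : nat) (hk : (1 <= k)%N) :
  (odd k -> R_infty k) /\ (~~ odd k -> ~ R_infty k).
Proof. by split; [exact: R_infty_odd | exact: not_R_infty_even]. Qed.
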